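(* Let $G$ be a finite simple graph, let $\mathcal{G}$ be the set of all simplices of $G$, let $\kappa(x)$ be the Lefschetz curvature of a simplex $x$, and let $L(G)$ be the average Lefschetz number of $G$. Then $$ \sum_{x\in\mathcal{G}} \kappa(x) = L(G). $$
   Context: For a finite simple graph $G=(V,E)$, a $k$-simplex is a complete subgraph $K_{k+1}$ of $G$ (identified with its vertex set), of dimension $\dim(x)=k\ge 0$; $\mathcal{G}$ is the set of all simplices. A $k$-form is a real-valued function $f(x_0,\dots,x_k)$ on ordered $k$-simplices that is antisymmetric in its $k+1$ arguments. The exterior derivative is $df(x_0,\dots,x_{k+1})=\sum_i (-1)^i f(x_0,\dots,\hat{x_i},\dots,x_{k+1})$. The cohomology group $H^k(G)$ is the real vector space of closed $k$-forms ($df=0$) modulo exact $k$-forms ($f=dg$). Let $\mathcal{A}=\mathrm{Aut}(G)$ be the (finite) group of graph automorphisms. Each $T\in\mathcal{A}$ induces by pull-back $f\mapsto f(T(\cdot),\dots,T(\cdot))$ a linear map $T_k$ on $H^k(G)$, and the Lefschetz number is $L(T)=\sum_{k\ge0}(-1)^k\mathrm{tr}(T_k)$. If $T(x)=x$ (as a set), the index is $i_T(x)=(-1)^{\dim(x)}\,\mathrm{sign}(T|x)$, where $\mathrm{sign}(T|x)$ is the signature of the permutation induced by $T$ on the vertices of $x$. For $x\in\mathcal{G}$ let $\mathcal{A}_x=\{T\in\mathcal{A}: T(x)=x\}$ be the stabilizer. The Lefschetz curvature of $x$ is $\kappa(x)=\frac{1}{|\mathcal{A}|}\sum_{T\in\mathcal{A}_x}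 i_T(x)$, and the average Lefschetz number is $L(G)=\frac{1}{|\mathcal{A}|}\sum_{T\in\mathcal{A}} L(T)$. *)

(* Defs.v *)
From HB Require Import structures.
From mathcomp Require Import all_boot all_order all_fingroup all_algebra.
From mathcomp Require Import reals.

Set Implicit Arguments.
Unset Strict Implicit.
Unset Printing Implicit Defensive.

Import Order.TTheory GRing.Theory Num.Theory.
Local Open Scope quotient_scope.
Local Open Scope ring_scope.

Section QuotientSpace.
Variables (K : fieldType) (vT : vectType K) (W : {vspace vT}).

(* [Quotient.quot] provides the additive group vT / W. *)
Definition quotv : Type := Quotient.quot W.
HB.instance Definition _ := GRing.Zmodule.copy quotv (Quotient.quot W).

Definition quotv_pi (v : vT) : quotv := \pi_(Quotient.quot W) v.
Definition quotv_repr (q : quotv) : vT := generic_quotient.repr (q : Quotient.quot W).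

Lemma quotv_reprK : cancel quotv_repr quotv_pi.
Proof. exact: reprK. Qed.

Lemma quotv_piE u v : (quotv_pi u == quotv_pi v) = (u - v \in W).
Proof. by rewrite Quotient.idealrBE. Qed.

Lemma quotv_piD u v : quotv_pi (u + v) = quotv_pi u + quotv_pi v.
Proof. exact: Quotient.pi_add. Qed.

Definition quotv_scale (a : K) (q : quotv) : quotv :=
  quotv_pi (a *: quotv_repr q).

Lemma quotv_piZ a v : quotv_pi (a *: v) = quotv_scale a (quotv_pi v).
Proof.
apply/eqP; rewrite quotv_piE -scalerBr memvZ // -quotv_piE.
by rewrite quotv_reprK.
Qed.

Fact quotv_scaleA a b q :
  quotv_scale a (quotv_scale b q) = quotv_scale (a * b) q.
Proof. by rewrite -(quotv_reprK q) -!quotv_piZ scalerA. Qed.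
Fact quotv_scale1 : left_id 1 quotv_scale.
Proof. by move=> q; rewrite -(quotv_reprK q) -!quotv_piZ scale1r. Qed.
Fact quotv_scaleDr : right_distributive quotv_scale +%R.
Proof.
move=> a p q; rewrite -(quotv_reprK p) -(quotv_reprK q).
by rewrite -!(quotv_piD, quotv_piZ) scalerDr.
Qed.
Fact quotv_scaleDl q : {morph quotv_scale^~ q : a b / a + b}.
Proof.
by move=> a b; rewrite -(quotv_reprK q) -!(quotv_piD, quotv_piZ) scalerDl.
Qed.

HB.instance Definition _ := GRing.Zmodule_isLmodule.Build K quotv
  quotv_scaleA quotv_scale1 quotv_scaleDr quotv_scaleDl.

Fact quotv_pi_linear : linear quotv_pi.
Proof. by move=> a u v; rewrite quotv_piD quotv_piZ. Qed.
HB.instance Definition _ := GRing.isSemilinear.Build K vT quotv _ quotv_pi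
  (GRing.semilinear_linear quotv_pi_linear).

Lemma quotv_pi_eq0 v : (quotv_pi v == 0) = (v \in W).
Proof. by rewrite -(linear0 quotv_pi) quotv_piE subr0. Qed.

(* The complement W^C supplied by the library maps isomorphically onto
   vT / W; it only serves to see that vT / W has finite dimension. *)
Fact quotv_vect_iso : Vector.axiom (\dim W^C) quotv.
Proof.
have capC : (W^C :&: W = 0)%VS by rewrite capvC capv_compl.
pose pr := daddv_pi W^C W; pose toC q := pr (quotv_repr q).
have toC_pi v : toC (quotv_pi v) = pr v.
  apply/eqP; rewrite -subr_eq0 -linearB /=.
  have wW : quotv_repr (quotv_pi v) - v \in W.
    by rewrite -quotv_piE quotv_reprK.
  apply/eqP; move: {v} (_ - _) wW => w wW.
  have := daddv_pi_add capC (subvP (addvSr _ _) _ wW).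
  rewrite (@daddv_pi_id _ _ W W^C) ?capv_compl //.
  by move/eqP; rewrite -subr_eq0 addrK => /eqP.
have toCK q : quotv_pi (toC q) = q.
  rewrite -[q in RHS]quotv_reprK; apply/eqP; rewrite quotv_piE.
  have := @daddv_pi_add _ _ _ _ (quotv_repr q) capC.
  rewrite addvC addv_complf memvf => /(_ isT) E.
  by rewrite -[X in _ - X]E opprD addrA subrr sub0r rpredN memv_pi.
exists (fun q => \row_i coord (vbasis W^C) i (toC q)).
  move=> a p q; apply/rowP => i; rewrite !mxE.
  rewrite -[p]quotv_reprK -[q]quotv_reprK -quotv_pi_linear !toC_pi.
  by rewrite !linearP.
exists (fun rw : 'rV_(\dim W^C) => quotv_pi (\sum_i rw 0 i *: (vbasis W^C)`_i)).
  move=> q; rewrite -[RHS]toCK; congr quotv_pi.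
  rewrite [RHS](coord_vbasis (memv_pi _ _ _)).
  by apply: eq_bigr => i _; rewrite mxE.
move=> rw; apply/rowP => i; rewrite mxE toC_pi /pr daddv_pi_id //.
  by rewrite coord_sum_free ?(basis_free (vbasisP _)).
by apply: rpred_sum => j _; rewrite rpredZ ?vbasis_mem ?memt_nth.
Qed.
HB.instance Definition _ := Lmodule_hasFinDim.Build K quotv quotv_vect_iso.

(* The endomorphism of vT / W induced by an endomorphism g of vT; it is the
   usual one as soon as g stabilizes W. *)
Definition quotv_map (g : 'End(vT)) : 'End(quotv) :=
  linfun (quotv_pi \o g \o quotv_repr).

Lemma quotv_mapE (g : 'End(vT)) v :
  (g @: W <= W)%VS -> quotv_map g (quotv_pi v) = quotv_pi (g v).
Proof.
move=> gW; have gpi u : quotv_pi (g (quotv_repr (quotv_pi u))) = quotv_pi (g u).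
  apply/eqP; rewrite quotv_piE -linearB (subvP gW) ?memv_img //.
  by rewrite -quotv_piE quotv_reprK.
have lin : linear (quotv_pi \o g \o quotv_repr).
  move=> a p q; rewrite -[p]quotv_reprK -[q]quotv_reprK -quotv_pi_linear /=.
  by rewrite !gpi !linearP.
pose h : {linear quotv -> quotv} := HB.pack (quotv_pi \o g \o quotv_repr)
  (GRing.isSemilinear.Build _ _ _ _ _ (GRing.semilinear_linear lin)).
by rewrite /quotv_map -[X in linfun X]/(h : _ -> _) lfunE /= gpi.
Qed.

End QuotientSpace.

Section LinearAlgebra.
Variables (K : fieldType) (vT : vectType K).

Definition lftrace (g : 'End(vT)) : K :=
  \tr (passmx.mxof (vbasis {:vT}) (vbasis {:vT}) g).

(* The endomorphism of the subspace Z induced by g; it is the usual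
   restriction as soon as g stabilizes Z. *)
Definition lfrestr (Z : {vspace vT}) (g : 'End(vT)) : 'End(subvs_of Z) :=
  (linfun (vsproj Z) \o g \o linfun vsval)%VF.

Lemma lfrestrE (Z : {vspace vT}) (g : 'End(vT)) z :
  (g @: Z <= Z)%VS -> vsval (lfrestr Z g z) = g (vsval z).
Proof.
move=> gZ; rewrite !comp_lfunE !lfunE /= vsprojK //.
by rewrite (subvP gZ) ?memv_img ?subvsP.
Qed.

End LinearAlgebra.

Record sgraph := SGraph {
  vertex :> finType;
  edge : rel vertex;
  edge_sym : symmetric edge;
  edge_irrefl : irreflexive edge }.

Section Simplices.
Variable G : sgraph.
Implicit Types (x : {set G}) (T : {perm G}).

Definition simplices : {set {set G}} :=
  [set x : {set G} | (x != set0) &&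
     [forall u in x, forall v in x, (u != v) ==> edge u v]].

Definition sdim x : nat := #|x|.-1.

Definition graph_aut : {set {perm G}} :=
  [set T : {perm G} | [forall u, forall v, edge (T u) (T v) == edge u v]].

Lemma graph_autP T :
  reflect (forall u v, edge (T u) (T v) = edge u v) (T \in graph_aut).
Proof.
rewrite inE; apply: (iffP forallP) => [h u v | h u].
  by have /forallP/(_ v)/eqP := h u.
by apply/forallP => v; rewrite h.
Qed.

Fact graph_aut_group_set : group_set graph_aut.
Proof.
apply/group_setP; split=> [|S T /graph_autP hS /graph_autP hT].
  by apply/graph_autP => u v; rewrite !perm1.
by apply/graph_autP => u v; rewrite !permM hT hS.
Qed.
Canonical graph_aut_group := Group graph_aut_group_set.

Definition stabilizer x : {set {perm G}} := [set T in graph_aut | T @: x == x].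

End Simplices.

Section Cohomology.
Variables (R : realType) (G : sgraph).

Definition is_osimplex k (x : {ffun 'I_k.+1 -> G}) : bool :=
  [forall i, forall j, (i != j) ==> edge (x i) (x j)].

(* Ordered k-simplices (x_0, ..., x_k). *)
Definition osimplex k : Type := {x : {ffun 'I_k.+1 -> G} | is_osimplex x}.
HB.instance Definition _ k := Finite.on (osimplex k).

Lemma is_osimplexP k (x : {ffun 'I_k.+1 -> G}) :
  reflect (forall i j, i != j -> edge (x i) (x j)) (is_osimplex x).
Proof.
apply: (iffP forallP) => [h i j ij | h i].
  by have /forallP/(_ j)/implyP := h i; apply.
by apply/forallP => j; apply/implyP/h.
Qed.

Lemma osimplex_lt_card k : osimplex k -> (k < #|G|)%N.
Proof.
case=> x /is_osimplexP x_edge; rewrite -[k.+1]card_ord.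
apply: (@leq_card _ _ x) => i j xij; apply/eqP/negP => /negP /x_edge.
by rewrite xij edge_irrefl.
Qed.

Fact oface_proof k (x : osimplex k.+1) (i : 'I_k.+2) :
  is_osimplex [ffun j : 'I_k.+1 => val x (lift i j)].
Proof.
apply/is_osimplexP => j l jl; rewrite !ffunE.
by apply: (is_osimplexP _ (valP x)); rewrite (inj_eq lift_inj).
Qed.
Definition oface k (x : osimplex k.+1) (i : 'I_k.+2) : osimplex k :=
  exist (fun y => is_osimplex y) _ (oface_proof x i).

Fact oreorder_proof k (s : 'S_k.+1) (x : osimplex k) :
  is_osimplex [ffun j : 'I_k.+1 => val x (s j)].
Proof.
apply/is_osimplexP => j l jl; rewrite !ffunE.
by apply: (is_osimplexP _ (valP x)); rewrite (inj_eq perm_inj).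
Qed.
Definition oreorder k (s : 'S_k.+1) (x : osimplex k) : osimplex k :=
  exist (fun y => is_osimplex y) _ (oreorder_proof s x).

Fact oimage_proof (T : subg_of (graph_aut_group G)) k (x : osimplex k) :
  is_osimplex [ffun j : 'I_k.+1 => sgval T (val x j)].
Proof.
apply/is_osimplexP => j l jl; rewrite !ffunE (graph_autP _ (subgP T)).
exact: (is_osimplexP _ (valP x)).
Qed.
Definition oimage (T : subg_of (graph_aut_group G)) k (x : osimplex k) :
  osimplex k := exist (fun y => is_osimplex y) _ (oimage_proof T x).

Definition cochain (k : nat) : Type := {ffun osimplex k -> R^o}.
HB.instance Definition _ k := Vector.on (cochain k).

Definition d_fun k (f : cochain k) : cochain k.+1 :=
  [ffun x => \sum_(i < k.+2) (-1) ^+ i * f (oface x i)].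
Definition reorder_fun k (s : 'S_k.+1) (f : cochain k) : cochain k :=
  [ffun x => f (oreorder s x)].
Definition pullback_fun (T : subg_of (graph_aut_group G)) k (f : cochain k) :
  cochain k := [ffun x => f (oimage T x)].

Fact d_fun_linear k : linear (@d_fun k).
Proof.
move=> a f g; apply/ffunP => x; rewrite !ffunE scaler_sumr -big_split /=.
by apply: eq_bigr => i _; rewrite !ffunE mulrDr scalerAr.
Qed.
HB.instance Definition _ k := GRing.isSemilinear.Build R (cochain k)
  (cochain k.+1) _ (@d_fun k) (GRing.semilinear_linear (@d_fun_linear k)).

Fact reorder_fun_linear k (s : 'S_k.+1) : linear (reorder_fun s).
Proof. by move=> a f g; apply/ffunP => x; rewrite !ffunE. Qed.
HB.instance Definition _ k s := GRing.isSemilinear.Build R (cochain k)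
  (cochain k) _ (@reorder_fun k s)
  (GRing.semilinear_linear (@reorder_fun_linear k s)).

Fact pullback_fun_linear T k : linear (@pullback_fun T k).
Proof. by move=> a f g; apply/ffunP => x; rewrite !ffunE. Qed.
HB.instance Definition _ T k := GRing.isSemilinear.Build R (cochain k)
  (cochain k) _ (@pullback_fun T k)
  (GRing.semilinear_linear (@pullback_fun_linear T k)).

Definition dform k : 'Hom(cochain k, cochain k.+1) := linfun (@d_fun k).
Definition reorder k (s : 'S_k.+1) : 'End(cochain k) := linfun (reorder_fun s).
Definition pullback T k : 'End(cochain k) := linfun (@pullback_fun T k).

(* [forms k] is the space of k-forms in the sense of [formsP]. *)
Definition forms k : {vspace cochain k} :=
  (\bigcap_(s : 'S_k.+1) lker (reorder s - (-1) ^+ s *: \1%VF))%VS.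

Lemma formsP k (f : cochain k) :
  reflect (forall (s : 'S_k.+1) x, f (oreorder s x) = (-1) ^+ s * f x)
          (f \in forms k).
Proof.
have E s : (f \in lker (reorder s - (-1) ^+ s *: \1%VF)) =
           (reorder_fun s f == (-1) ^+ s *: f).
  rewrite memv_ker add_lfunE opp_lfunE scale_lfunE id_lfunE /reorder lfunE.
  by rewrite subr_eq0.
apply: (iffP idP) => [fA s x | h].
  have : f \in lker (reorder s - (-1) ^+ s *: \1%VF).
    by apply: (subvP (bigcapv_inf s _ (subvv _))) fA.
  by rewrite E => /eqP/ffunP/(_ x); rewrite !ffunE.
rewrite memvE; apply/subv_bigcapP => s _; rewrite -memvE E.
by apply/eqP/ffunP => x; rewrite !ffunE h.
Qed.

Definition cocycles k : {vspace cochain k} := (forms k :&: lker (dform k))%VS.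

Definition coboundaries k : {vspace cochain k} :=
  match k with 0 => 0%VS | k'.+1 => (dform k' @: forms k')%VS end.

Definition coboundaries_in_cocycles k : {vspace subvs_of (cocycles k)} :=
  (linfun vsval @^-1: coboundaries k)%VS.

Lemma pullback_forms T k f : f \in forms k -> pullback T k f \in forms k.
Proof.
move=> /formsP fA; apply/formsP => s x; rewrite !lfunE /= !ffunE -fA.
by congr (f _); apply: val_inj; apply/ffunP => j; rewrite /= !ffunE.
Qed.

Lemma pullback_d T k f : pullback T k.+1 (dform k f) = dform k (pullback T k f).
Proof.
apply/ffunP => x; rewrite !lfunE /= !ffunE; apply: eq_bigr => i _.
rewrite !ffunE; congr (_ * f _); apply: val_inj; apply/ffunP => j.
by rewrite /= !ffunE.
Qed.

Lemma pullback_cocycles T k : (pullback T k @: cocycles k <= cocycles k)%VS.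
Proof.
apply/subvP => _ /memv_imgP[f /memv_capP[fA /[!memv_ker]/eqP df0] ->].
apply/memv_capP; split; first exact: pullback_forms.
by rewrite memv_ker -pullback_d df0 linear0.
Qed.

Lemma pullback_coboundaries T k f :
  f \in coboundaries k -> pullback T k f \in coboundaries k.
Proof.
case: k f => [|k] f /=; first by rewrite !memv0 => /eqP->; rewrite linear0.
by case/memv_imgP => g gA ->; rewrite pullback_d memv_img ?pullback_forms.
Qed.

Definition cohomology k : vectType R := quotv (coboundaries_in_cocycles k).

(* The map T_k induced by the pull-back along T; see [cohomology_mapE]. *)
Definition cohomology_map T k : 'End(cohomology k) :=
  quotv_map (coboundaries_in_cocycles k) (lfrestr (cocycles k) (pullback T k)).

Lemma cohomology_mapE T k (z : subvs_of (cocycles k)) :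
  cohomology_map T k (quotv_pi _ z) =
    quotv_pi _ (vsproj (cocycles k) (pullback T k (vsval z))).
Proof.
have sZ := pullback_cocycles T k; rewrite quotv_mapE.
  by congr quotv_pi; rewrite -(lfrestrE _ sZ) vsvalK.
apply/subvP => _ /memv_imgP[w wB ->]; move: wB.
rewrite -!memv_preim [linfun _ w]lfunE [linfun _ (_ w)]lfunE /= lfrestrE //.
exact: pullback_coboundaries.
Qed.

(* By [osimplex_lt_card] all forms of degree k >= #|G| are zero. *)
Definition lefschetz_number T : R :=
  \sum_(k < #|G|) (-1) ^+ k * lftrace (cohomology_map T k).

Definition average_lefschetz_number : R :=
  #|graph_aut G|%:R^-1 *
    \sum_(T : subg_of (graph_aut_group G)) lefschetz_number T.

(* [restr_perm x T] is the permutation induced by T on x when T @: x = x. *)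
Definition lefschetz_index (T : {perm G}) (x : {set G}) : R :=
  (-1) ^+ sdim x * (-1) ^+ restr_perm x T.

Definition lefschetz_curvature (x : {set G}) : R :=
  #|graph_aut G|%:R^-1 * \sum_(T in stabilizer x) lefschetz_index T x.

End Cohomology.

(* Main.v *)
Require Import Defs.
From HB Require Import structures.
From mathcomp Require Import all_boot all_order all_fingroup all_algebra.
From mathcomp Require Import reals zify.
Import GRing.Theory Num.Theory passmx.
Local Open Scope ring_scope.

(** Both sides are averages over the automorphism group [graph_aut G]: after
    exchanging the sum over simplices with the sum over the stabilizer of each
    simplex, the identity reduces to the Lefschetz fixed point formula for a
    single automorphism [T] ([lefschetz_fixed_point]): the Lefschetz number
    [L(T)] is the sum of the indices [i_T(x)] over the simplices [x] with
    [T(x) = x].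

    That formula has two parts.

    The first is the Hopf trace formula ([hopf_trace]): the alternating sum of
    the traces of [T] on cohomology equals the alternating sum of its traces
    on the spaces of forms.  Everything rests on the additivity of the trace
    in short exact sequences ([lftrace_exact]), applied to
    [0 -> Z^k -> C^k -> B^(k+1) -> 0] and [0 -> B^k -> Z^k -> H^k -> 0]; the
    contributions of the coboundaries telescope.  Additivity is in turn
    deduced from [tr (g f) = tr (f g)] by splitting the sequence.  That the
    forms constitute a complex ([dform_forms], [dform_dform]) has to be proved
    as well.

    The second is the trace of [T] on the space of [k]-forms.  Rather than
    choosing an orientation of every simplex, the forms are regarded as the
    image of the antisymmetrizer inside the space of all functions on ordered
    simplices, so that the wanted trace is the trace of the pull-back composed
    with the antisymmetrizer ([lftrace_restr]).  On the basis of indicator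
    functions, this is a sum over the ordered simplices [y] and the
    permutations [s] such that [T y] reordered by [s] is [y].  Such an [s]
    exists if and only if [T] fixes the underlying simplex; it is then unique
    and its sign is that of the restriction of [T] ([sum_reorder_image]).
    Each simplex has [(k+1)!] orderings ([sum_overtices]), which cancels the
    normalization of the antisymmetrizer. *)

Set Implicit Arguments.
Unset Strict Implicit.
Unset Printing Implicit Defensive.

(** * Traces of linear endomorphisms *)

Section Trace.
Variable K : fieldType.
Implicit Types U V W : vectType K.

Lemma lftraceC U V (f : 'Hom(U, V)) (g : 'Hom(V, U)) :
  lftrace (g \o f)%VF = lftrace (f \o g)%VF.
Proof.
have bas W : basis_of {:W} (vbasis {:W}) := vbasisP _.
rewrite /lftrace (passmx.mxof_comp _ _ (bas V)) (passmx.mxof_comp _ _ (bas U)).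
exact: mxtrace_mulC.
Qed.

Lemma lftraceD V (f g : 'End(V)) : lftrace (f + g) = lftrace f + lftrace g.
Proof. by rewrite /lftrace !raddfD. Qed.

Lemma lftraceZ V a (f : 'End(V)) : lftrace (a *: f) = a * lftrace f.
Proof. by rewrite /lftrace linearZ /= mxtraceZ. Qed.

Lemma lftrace_sum V I (r : seq I) (P : pred I) (F : I -> 'End(V)) :
  lftrace (\sum_(i <- r | P i) F i) = \sum_(i <- r | P i) lftrace (F i).
Proof. by rewrite /lftrace !raddf_sum. Qed.

Lemma lftrace1 V : lftrace (\1%VF : 'End(V)) = (\dim {:V})%:R.
Proof.
by rewrite /lftrace passmx.mxof1 ?mxtrace1 // (basis_free (vbasisP _)).
Qed.

Lemma lftrace_dim0 V (f : 'End(V)) : (forall v : V, v = 0) -> lftrace f = 0.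
Proof.
move=> V0; suff -> : f = 0 by rewrite /lftrace !raddf0.
by apply/lfunP => v; rewrite [LHS]V0 [RHS]V0.
Qed.

(** Additivity of the trace in a short exact sequence [0 -> U -> V -> W -> 0]
    of spaces with compatible endomorphisms. *)
Lemma lftrace_exact U V W (i : 'Hom(U, V)) (p : 'Hom(V, W))
    (gU : 'End(U)) (gV : 'End(V)) (gW : 'End(W)) :
    injective i -> (forall w, exists v, p v = w) ->
    (forall v, p v = 0 <-> exists u, v = i u) ->
    (forall u, gV (i u) = i (gU u)) -> (forall v, p (gV v) = gW (p v)) ->
  lftrace gV = lftrace gU + lftrace gW.
Proof.
move=> i_inj p_surj kerp gi gp.
have iK : cancel i i^-1%VF by apply: lker0_lfunK; apply/lker0P.
(* A section [s] of [p] and the retraction [r] of [i] complementary to it: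
   [i r + s p] is the identity of [V]. *)
pose s := (p^-1)%VF.
have sK w : p (s w) = w.
  by have [v <-] := p_surj w; rewrite limg_lfunVK // memv_img ?memvf.
pose r := (i^-1 \o (\1 - (s \o p)))%VF.
have irE v : i (r v) = v - s (p v).
  rewrite !(comp_lfunE, add_lfunE, opp_lfunE, id_lfunE) /=.
  have /kerp[u ->] : p (v - s (p v)) = 0 by rewrite linearB /= sK subrr.
  by rewrite iK.
clearbody r; clearbody s.
have riE u : r (i u) = u.
  have pi0 : p (i u) = 0 by apply/kerp; exists u.
  by apply: i_inj; rewrite irE pi0 linear0 subr0.
have -> : gV = ((i \o (gU \o r)) + ((gV \o s) \o p))%VF.
  apply/lfunP => v; rewrite add_lfunE !comp_lfunE /= -gi irE linearB /=.
  by rewrite subrK.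
rewrite lftraceD (lftraceC _ i) (lftraceC p).
congr (_ + _); congr lftrace; apply/lfunP => v; rewrite !comp_lfunE /=.
  by rewrite riE.
by rewrite gp sK.
Qed.

(** If [P] is a projection onto a [g]-stable subspace [Z], the trace of [g] on
    [Z] is the trace of [g P] on the whole space. *)
Lemma lftrace_restr V (Z : {vspace V}) (g P : 'End(V)) :
    (g @: Z <= Z)%VS -> (forall v, P v \in Z) ->
    (forall v, v \in Z -> P v = v) ->
  lftrace (lfrestr Z g) = lftrace (g \o P)%VF.
Proof.
move=> gZ PZ Pid.
pose i : 'Hom(subvs_of Z, V) := linfun vsval.
pose q : 'Hom(V, subvs_of Z) := (linfun (vsproj Z) \o P)%VF.
have -> : (g \o P = (g \o i) \o q)%VF.
  by apply/lfunP => v; rewrite !comp_lfunE /= !lfunE /= vsprojK.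
rewrite [RHS]lftraceC; congr lftrace; apply/lfunP => z.
apply: subvs_inj.
rewrite /= lfrestrE // !comp_lfunE [i z]lfunE [linfun _ _]lfunE /=.
have gz : g (vsval z) \in Z by rewrite (subvP gZ) ?memv_img ?subvsP.
by rewrite (Pid _ gz) vsprojK.
Qed.

Lemma lftrace_regular (h : 'End(K^o)) : lftrace h = h 1.
Proof.
have -> : h = (h 1 : K) *: \1%VF.
  apply/lfunP => a; rewrite scale_lfunE id_lfunE.
  have -> : h a = a *: h 1 by rewrite -linearZ /= [a *: _]mulr1.
  exact: mulrC.
by rewrite lftraceZ lftrace1 dimvf scale_lfunE id_lfunE.
Qed.

(** The sum of the diagonal entries in the basis of indicator functions. *)
Lemma lftrace_ffun (X : finType) (g : 'End({ffun X -> K^o})) :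
  lftrace g = \sum_x g [ffun y => (y == x)%:R] x.
Proof.
pose ev x (f : {ffun X -> K^o}) : K^o := f x.
have ev_lin x : linear (ev x) by move=> a u v; rewrite /ev !ffunE.
pose evL x : {linear {ffun X -> K^o} -> K^o} := HB.pack (ev x)
  (GRing.isSemilinear.Build _ _ _ _ _ (GRing.semilinear_linear (ev_lin x))).
pose io x (a : K^o) : {ffun X -> K^o} := [ffun y => a * (y == x)%:R].
have io_lin x : linear (io x).
  by move=> a u v; apply/ffunP => y; rewrite !ffunE mulrDl -scalerAl.
pose ioL x : {linear K^o -> {ffun X -> K^o}} := HB.pack (io x)
  (GRing.isSemilinear.Build _ _ _ _ _ (GRing.semilinear_linear (io_lin x))).
have evE x f : linfun (evL x) f = f x by rewrite lfunE.
have ioE x a : linfun (ioL x) a = [ffun y => a * (y == x)%:R] by rewrite lfunE.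
(* The identity is the sum of the rank one maps [f |-> f x *: delta_x]. *)
have -> : lftrace g =
    lftrace (\sum_x ((g \o linfun (ioL x)) \o linfun (evL x)))%VF.
  congr lftrace; apply/lfunP => f; rewrite sum_lfunE.
  under eq_bigr => x _ do rewrite comp_lfunE (comp_lfunE g) evE ioE.
  rewrite -linear_sum; congr (g _); apply/ffunP => y.
  rewrite sum_ffunE (bigD1 y) //= big1 ?addr0 => [|x /negPf xy]; rewrite !ffunE.
    by rewrite eqxx mulr1.
  by rewrite eq_sym xy mulr0.
rewrite lftrace_sum; apply: eq_bigr => x _.
rewrite lftraceC lftrace_regular comp_lfunE (comp_lfunE _ (linfun (ioL x))).
rewrite evE ioE; congr (g _ _).
by apply/ffunP => y; rewrite !ffunE mul1r.
Qed.

End Trace.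

Section TraceSub.
Variable K : fieldType.
Implicit Types V : vectType K.

(** Additivity of the trace for [0 -> C :&: lker f -> C -> f @: C -> 0]. *)
Lemma lftrace_ker_img V V' (f : 'Hom(V, V')) (C : {vspace V}) (g : 'End(V))
    (g' : 'End(V')) :
    (g @: C <= C)%VS -> (forall v, f (g v) = g' (f v)) ->
  lftrace (lfrestr C g) =
    lftrace (lfrestr (C :&: lker f) g) + lftrace (lfrestr (f @: C) g').
Proof.
move=> gC fg; set Z := (C :&: lker f)%VS; set B := (f @: C)%VS.
have gZ : (g @: Z <= Z)%VS.
  apply/subvP => _ /memv_imgP[v /memv_capP[vC /[!memv_ker]/eqP fv0] ->].
  by apply/memv_capP; rewrite memv_ker fg fv0 linear0 (subvP gC) ?memv_img //.
have gB : (g' @: B <= B)%VS.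
  apply/subvP => _ /memv_imgP[_ /memv_imgP[v vC ->] ->].
  by rewrite -fg memv_img // (subvP gC) ?memv_img.
pose i : 'Hom(subvs_of Z, subvs_of C) :=
  (linfun (vsproj C) \o linfun vsval)%VF.
pose p : 'Hom(subvs_of C, subvs_of B) :=
  (linfun (vsproj B) \o (f \o linfun vsval))%VF.
have iE z : vsval (i z) = vsval z.
  rewrite comp_lfunE [linfun _ z]lfunE [linfun _ _]lfunE /= vsprojK //.
  by have /memv_capP[] := subvsP z.
have pE c : vsval (p c) = f (vsval c).
  rewrite comp_lfunE (comp_lfunE f) [linfun _ c]lfunE [linfun _ _]lfunE /=.
  by rewrite vsprojK // memv_img ?subvsP.
clearbody i p; apply: (lftrace_exact (i := i) (p := p)).
- by move=> z1 z2 /(congr1 vsval); rewrite !iE => /subvs_inj.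
- move=> b; have /memv_imgP[v vC bE] := subvsP b.
  by exists (vsproj C v); apply: subvs_inj; rewrite pE vsprojK.
- move=> c; split=> [/(congr1 vsval) | [z ->]]; last first.
    apply: subvs_inj; rewrite pE iE linear0; apply/eqP; rewrite -memv_ker.
    by have /memv_capP[] := subvsP z.
  rewrite pE linear0 => /eqP; rewrite -memv_ker => fc0.
  exists (vsproj Z (vsval c)); apply: subvs_inj.
  by rewrite iE vsprojK //; apply/memv_capP; rewrite subvsP.
- by move=> z; apply: subvs_inj; rewrite lfrestrE // !iE lfrestrE.
- by move=> c; apply: subvs_inj; rewrite pE !lfrestrE // pE.
Qed.

(** Additivity of the trace for [0 -> W -> Z -> Z / W -> 0]. *)
Lemma lftrace_quot V (W Z : {vspace V}) (g : 'End(V)) :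
    (W <= Z)%VS -> (g @: W <= W)%VS -> (g @: Z <= Z)%VS ->
  lftrace (lfrestr Z g) = lftrace (lfrestr W g) +
    lftrace (quotv_map (linfun vsval @^-1: W) (lfrestr Z g)).
Proof.
move=> WZ gW gZ; set W' : {vspace subvs_of Z} := (linfun vsval @^-1: W)%VS.
have W'E z : (z \in W') = (vsval z \in W) by rewrite -memv_preim lfunE.
have gW' : (lfrestr Z g @: W' <= W')%VS.
  apply/subvP => _ /memv_imgP[z + ->]; rewrite !W'E lfrestrE // => zW.
  by rewrite (subvP gW) ?memv_img.
pose i : 'Hom(subvs_of W, subvs_of Z) :=
  (linfun (vsproj Z) \o linfun vsval)%VF.
pose p : 'Hom(subvs_of Z, quotv W') := linfun (quotv_pi W').
have iE w : vsval (i w) = vsval w.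
  rewrite comp_lfunE [linfun _ w]lfunE [linfun _ _]lfunE /= vsprojK //.
  by rewrite (subvP WZ) ?subvsP.
have pE z : p z = quotv_pi W' z by rewrite /p lfunE.
clearbody i p; apply: (lftrace_exact (i := i) (p := p)).
- by move=> w1 w2 /(congr1 vsval); rewrite !iE => /subvs_inj.
- by move=> q; exists (quotv_repr q); rewrite pE quotv_reprK.
- move=> z; rewrite pE; split=> [/eqP | [w ->]].
    rewrite quotv_pi_eq0 W'E => zW; exists (vsproj W (vsval z)).
    by apply: subvs_inj; rewrite iE vsprojK.
  by apply/eqP; rewrite quotv_pi_eq0 W'E iE subvsP.
- by move=> w; apply: subvs_inj; rewrite lfrestrE // !iE lfrestrE.
- by move=> z; rewrite !pE quotv_mapE.
Qed.
End TraceSub.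

(** * The complex of antisymmetric forms *)

Section Faces.
Variable n : nat.
Implicit Types p q : 'I_n.+2 * 'I_n.+1.

(** A pair [(i, j)] encodes the successive omission of the [i]-th vertex and
    of the [j]-th remaining one, whose original index is [lift i j].  The map
    [face_swap] omits the same two vertices in the opposite order.  The default
    value of [odflt] is never used, since [lift i j != i]. *)
Definition face_swap p : 'I_n.+2 * 'I_n.+1 :=
  (lift p.1 p.2, odflt p.2 (unlift (lift p.1 p.2) p.1)).

Lemma face_swapE p : lift (face_swap p).1 (face_swap p).2 = p.1.
Proof.
rewrite /face_swap /=; case: unliftP => [j //|/eqP].
by rewrite eq_liftF.
Qed.

Lemma face_swapK : involutive face_swap.
Proof.
move=> [i j]; rewrite {1}/face_swap face_swapE /=.
by rewrite liftK.
Qed.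

Lemma lift_face_swap p (m : 'I_n) :
  lift (face_swap p).1 (lift (face_swap p).2 m) = lift p.1 (lift p.2 m).
Proof.
have aE : (face_swap p).1 = bump p.1 p.2 :> nat by [].
have := congr1 val (face_swapE p); case: p aE => i j.
case: face_swap => a b /=; rewrite /bump => aE.
move=> iE; apply: val_inj; rewrite /= /bump; lia.
Qed.

Lemma odd_face_swap p :
  odd ((face_swap p).1 + (face_swap p).2) = ~~ odd (p.1 + p.2).
Proof.
have aE : (face_swap p).1 = bump p.1 p.2 :> nat by [].
have := congr1 val (face_swapE p); case: p aE => i j.
case: face_swap => a b /=; rewrite /bump => aE.
by lia.
Qed.

(** Every permutation [s] restricts, for each [i], to a permutation [t] of the
    indices other than [i] onto those other than [s i]. *)
Lemma perm_lift_perm (s : 'S_n.+1) i : exists t : 'S_n, s = lift_perm i (s i) t.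
Proof.
pose t j := odflt j (unlift (s i) (s (lift i j))).
have tE j : lift (s i) (t j) = s (lift i j).
  rewrite /t; case: unliftP => [//|/perm_inj/esym/eqP].
  by rewrite eq_liftF.
have t_inj : injective t.
  by move=> j l /(congr1 (lift (s i))); rewrite !tE => /perm_inj/lift_inj.
exists (perm t_inj); apply/permP => j.
case: (unliftP i j) => [l|] ->; last by rewrite lift_perm_id.
by rewrite lift_perm_lift permE tE.
Qed.
End Faces.

Section Complex.
Variables (R : realType) (G : sgraph).

(** The [i]-th face of a reordered simplex is a reordering of the face opposite
    to the vertex of index [s i]; the signs are compared by [odd_lift_perm]. *)
Lemma dform_forms k (f : cochain R G k) : f \in forms R G k ->
  dform R G k f \in forms R G k.+1.
Proof.
move=> /formsP f_alt; apply/formsP => s x.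
rewrite !lfunE /= !ffunE [in RHS](reindex_inj (@perm_inj _ s)) mulr_sumr.
apply: eq_bigr => i _; have [t sE] := perm_lift_perm s i.
have -> : oface (oreorder s x) i = oreorder t (oface x (s i)).
  apply/val_inj/ffunP => j; rewrite /= !ffunE; congr (val x _).
  by rewrite [in LHS]sE lift_perm_lift.
rewrite f_alt !mulrA; congr (_ * _).
have -> : odd_perm s = odd i (+) odd (s i) (+) t by rewrite {1}sE odd_lift_perm.
rewrite -(signr_odd R i) -(signr_odd R (s i)) -!signr_addb.
by case: (odd i); case: (odd (s i)); case: (odd_perm t).
Qed.

Lemma dform_dform k (f : cochain R G k) : dform R G k.+1 (dform R G k f) = 0.
Proof.
apply/ffunP => x; rewrite !lfunE /= !ffunE.
pose F (p : 'I_k.+3 * 'I_k.+2) : R :=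
  (-1) ^+ (p.1 + p.2) * f (oface (oface x p.1) p.2).
transitivity (\sum_p F p).
  rewrite -(pair_bigA _ (fun i j => F (i, j))) /=; apply: eq_bigr => i _.
  by rewrite ffunE mulr_sumr; apply: eq_bigr => j _; rewrite /F exprD mulrA.
(* The involution [face_swap] changes the sign of every term, so the sum
   equals its own opposite. *)
have FN : \sum_p F p = - \sum_p F p.
  rewrite [LHS](reindex_inj (inv_inj (@face_swapK _))) -sumrN.
  apply: eq_bigr => p _; rewrite /F -signr_odd odd_face_swap signrN mulNr.
  rewrite signr_odd; congr (- (_ * f _)); apply/val_inj/ffunP => j.
  by rewrite /= !ffunE lift_face_swap.
by apply/eqP; rewrite -[_ == 0](@mulrn_eq0 R _ 2) mulr2n {1}FN addNr.
Qed.
End Complex.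

(** * The Hopf trace formula *)

Section HopfTrace.
Variables (R : realType) (G : sgraph) (T : subg_of (graph_aut_group G)).

Lemma coboundaries_cocycles k : (coboundaries R G k <= cocycles R G k)%VS.
Proof.
case: k => [|k]; first exact: sub0v.
apply/subvP => _ /memv_imgP[f fA ->]; apply/memv_capP.
by rewrite dform_forms // memv_ker dform_dform.
Qed.

Lemma lftrace_forms_cohomology k :
  lftrace (lfrestr (forms R G k) (pullback R T k)) =
  lftrace (lfrestr (coboundaries R G k) (pullback R T k)) +
  lftrace (cohomology_map R T k) +
  lftrace (lfrestr (coboundaries R G k.+1) (pullback R T k.+1)).
Proof.
rewrite (lftrace_ker_img (f := dform R G k) (g' := pullback R T k.+1)).
- rewrite -/(cocycles R G k) (lftrace_quot (coboundaries_cocycles k)) //.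
  + by apply/subvP => _ /memv_imgP[f fB ->]; apply: pullback_coboundaries.
  + exact: pullback_cocycles.
- by apply/subvP => _ /memv_imgP[f fA ->]; apply: pullback_forms.
- by move=> f; rewrite pullback_d.
Qed.

Lemma hopf_trace : lefschetz_number R T =
  \sum_(k < #|G|) (-1) ^+ k * lftrace (lfrestr (forms R G k) (pullback R T k)).
Proof.
pose b k := lftrace (lfrestr (coboundaries R G k) (pullback R T k)).
(* Truncated sums differ, up to sign, by the trace on the next coboundaries. *)
have telescope m : \sum_(k < m) (-1) ^+ k *
    lftrace (lfrestr (forms R G k) (pullback R T k)) =
  \sum_(k < m) (-1) ^+ k * lftrace (cohomology_map R T k) - (-1) ^+ m * b m.
  elim: m => [|m IH].
    rewrite !big_ord0 /b lftrace_dim0 ?mulr0 ?subrr // => v.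
    apply: subvs_inj; rewrite linear0; apply/eqP; rewrite -memv0.
    exact: subvsP.
  rewrite !big_ord_recr /= IH lftrace_forms_cohomology -/(b m) -/(b m.+1).
  by rewrite exprS mulN1r mulNr opprK !mulrDr !addrA subrK.
(* There is no ordered simplex of dimension [#|G|], hence no form. *)
have b0 : b #|G| = 0.
  apply: lftrace_dim0 => v; apply: subvs_inj; apply/ffunP => x.
  by have := osimplex_lt_card x; rewrite ltnn.
by rewrite telescope b0 mulr0 subr0.
Qed.
End HopfTrace.

(** * Signatures of permutations *)

Section PermTransport.
Variables (I X : finType) (y : I -> X).
Hypothesis y_inj : injective y.

(** A permutation of the domain of an injection [y] induces a permutation of
    its codomain, supported by the image of [y], with the same signature. *)
Lemma perm_transport (t : {perm I}) : exists q : {perm X},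
  [/\ forall j, q (y j) = y (t j), forall v, v \notin codom y -> q v = v
    & odd_perm q = odd_perm t].
Proof.
have [ts -> _] := prod_tpermP t; elim: ts => [|[a b] ts [q [qy qN q_odd]]].
  by exists 1%g; rewrite big_nil; split=> [j|v _|]; rewrite ?perm1 ?odd_perm1.
exists (tperm (y a) (y b) * q)%g; rewrite big_cons; split=> [j|v vN|] /=.
- by rewrite !permM -inj_tperm // qy.
- have [va vb] : y a != v /\ y b != v.
    by split; apply: contraNneq vN => <-; apply: codom_f.
  by rewrite permM tpermD // qN.
- by rewrite !odd_permM !odd_tperm q_odd (inj_eq y_inj).
Qed.

Lemma odd_restr_perm_codom (p : {perm X}) (t : {perm I}) :
    (forall j, p (y j) = y (t j)) ->
  odd_perm (restr_perm [set y j | j : I] p) = odd_perm t.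
Proof.
move=> py; have [q [qy qN <-]] := perm_transport t; congr odd_perm.
set x := [set y j | j : I].
have pN : p \in ('N(x | 'P))%g.
  apply/astabsP => v /=; rewrite apermE.
  apply/imsetP/imsetP => -[j _ vE]; last by exists (t j); rewrite // vE.
  exists ((t^-1)%g j) => //; apply: (@perm_inj _ p).
  by rewrite py permKV.
apply/permP => v; have [/imsetP[j _ ->]|vx] := boolP (v \in x).
  by rewrite restr_permE ?imset_f // py qy.
rewrite (out_perm (restr_perm_on _ _) vx) qN //.
by apply: contra vx => /codomP[j ->]; apply: imset_f.
Qed.
End PermTransport.

(** * The trace on forms and the fixed point formula *)

Section TraceForms.
Variables (R : realType) (G : sgraph).

(** The set of vertices of an ordered simplex. *)
Definition overtices k (y : osimplex G k) : {set G} :=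
  [set val y j | j : 'I_k.+1].

Lemma osimplex_inj k (y : osimplex G k) : injective (val y).
Proof.
move=> i j yij; apply/eqP/negPn/negP => /(is_osimplexP _ (valP y)).
by rewrite yij edge_irrefl.
Qed.

Lemma card_overtices k (y : osimplex G k) : #|overtices y| = k.+1.
Proof. by rewrite card_imset ?card_ord //; apply: osimplex_inj. Qed.

Lemma overtices_simplex k (y : osimplex G k) : overtices y \in simplices G.
Proof.
rewrite inE -card_gt0 card_overtices /=.
apply/'forall_implyP => _ /imsetP[i _ ->].
apply/'forall_implyP => _ /imsetP[j _ ->]; apply/implyP => ij.
by apply: (is_osimplexP _ (valP y)); apply: contraNneq ij => ->.
Qed.

(** The orderings of a simplex [x] are the injections of ['I_k.+1] into [x]. *)
Lemma card_orderings k (x : {set G}) : x \in simplices G -> #|x| = k.+1 ->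
  #|[set y : osimplex G k | overtices y == x]| = (k.+1)`!.
Proof.
rewrite inE => /andP[_ /'forall_implyP xP] x_card.
have := card_inj_ffuns_on 'I_k.+1 (mem x).
rewrite card_ord x_card ffactnn => <-; rewrite -(card_imset _ val_inj).
apply: eq_card => f; rewrite [RHS]inE; apply/imsetP/andP.
  case=> y; rewrite inE => /eqP <- ->; split.
    by apply/ffun_onP => j; apply: imset_f.
  by apply/injectiveP/osimplex_inj.
case=> /ffun_onP fx /injectiveP f_inj.
have f_os : is_osimplex f.
  apply/is_osimplexP => i j ij.
  have /'forall_implyP/(_ _ (fx j))/implyP := xP _ (fx i).
  by apply; rewrite inj_eq.
exists (exist (fun z => is_osimplex z) f f_os) => //; rewrite inE.
rewrite eqEcard card_overtices x_card leqnn andbT.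
by apply/subsetP => _ /imsetP[j _ ->].
Qed.

Lemma sum_overtices k (F : {set G} -> R) :
  \sum_(y : osimplex G k) F (overtices y) =
  (k.+1)`!%:R * \sum_(x in simplices G | #|x| == k.+1) F x.
Proof.
rewrite (partition_big (@overtices k)
           (fun x => (x \in simplices G) && (#|x| == k.+1))) /=; last first.
  by move=> y _; rewrite overtices_simplex card_overtices /=.
rewrite mulr_sumr; apply: eq_bigr => x /andP[xG /eqP x_card].
rewrite -(card_orderings xG x_card) mulr_natl -sumr_const.
by apply: eq_big => [y|y /eqP ->]; rewrite ?inE.
Qed.

(** The projection of the space of all [k]-cochains onto that of [k]-forms. *)
Definition antisymmetrizer k : 'End(cochain R G k) :=
  (k.+1)`!%:R^-1 *: \sum_(s : 'S_k.+1) (-1) ^+ s *: reorder R G s.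

Lemma antisymmetrizerE k (f : cochain R G k) y : antisymmetrizer k f y =
  (k.+1)`!%:R^-1 * \sum_(s : 'S_k.+1) (-1) ^+ s * f (oreorder s y).
Proof.
rewrite scale_lfunE sum_lfunE ffunE sum_ffunE; congr (_ * _).
by apply: eq_bigr => s _; rewrite scale_lfunE lfunE /= !ffunE.
Qed.

Lemma antisymmetrizer_forms k (f : cochain R G k) :
  antisymmetrizer k f \in forms R G k.
Proof.
apply/formsP => t y; rewrite !antisymmetrizerE mulrCA; congr (_ * _).
rewrite [in RHS](reindex_inj (mulIg t)) mulr_sumr; apply: eq_bigr => s _ /=.
have -> : oreorder s (oreorder t y) = oreorder (s * t)%g y.
  by apply/val_inj/ffunP => j; rewrite /= !ffunE permM.
rewrite mulrA -signr_addb odd_permM; congr (_ * _).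
by rewrite addbC -addbA addbb addbF.
Qed.

Lemma antisymmetrizer_id k (f : cochain R G k) : f \in forms R G k ->
  antisymmetrizer k f = f.
Proof.
move=> /formsP f_alt; apply/ffunP => y; rewrite antisymmetrizerE.
under eq_bigr => s _ do rewrite f_alt signrMK.
rewrite sumr_const card_Sn -[f y *+ _]mulr_natl mulKf //.
by rewrite pnatr_eq0 -lt0n fact_gt0.
Qed.

Variable T : subg_of (graph_aut_group G).

Lemma lftrace_forms k : lftrace (lfrestr (forms R G k) (pullback R T k)) =
  (k.+1)`!%:R^-1 * \sum_(y : osimplex G k) \sum_(s : 'S_k.+1)
    (-1) ^+ s * (oreorder s (oimage T y) == y)%:R.
Proof.
rewrite (lftrace_restr _ (@antisymmetrizer_forms k) (@antisymmetrizer_id k)).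
  rewrite lftrace_ffun mulr_sumr; apply: eq_bigr => y _.
  rewrite comp_lfunE lfunE /= ffunE antisymmetrizerE; congr (_ * _).
  by apply: eq_bigr => s _; rewrite ffunE.
by apply/subvP => _ /memv_imgP[f fA ->]; apply: pullback_forms.
Qed.

Lemma sum_reorder_image k (y : osimplex G k) :
  \sum_(s : 'S_k.+1) (-1) ^+ s * (oreorder s (oimage T y) == y)%:R =
  if sgval T @: overtices y == overtices y
  then (-1) ^+ restr_perm (overtices y) (sgval T) else 0 :> R.
Proof.
have reorderP (s : 'S_k.+1) :
  reflect (forall j, sgval T (val y j) = val y ((s^-1)%g j))
    (oreorder s (oimage T y) == y).
  apply: (iffP eqP) => [/(congr1 val)/ffunP sE j | sE].
    by have := sE ((s^-1)%g j); rewrite !ffunE permKV.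
  by apply/val_inj/ffunP => j; rewrite /= !ffunE sE permK.
(* A reordering of [T y] into [y] forces [T] to preserve the vertices. *)
case: eqP => [TyE | TyN]; last first.
  rewrite big1 // => s _; case: reorderP => [sE|_]; last by rewrite mulr0.
  case: TyN; apply/eqP; rewrite eqEcard card_imset ?leqnn ?andbT.
    2: exact: perm_inj.
  by apply/subsetP => _ /imsetP[_ /imsetP[j _ ->] ->]; rewrite sE imset_f.
(* Conversely, [T y] is the composite of [y] with a unique permutation [t],
   and only [s = t^-1] contributes. *)
have Ty j : exists i, sgval T (val y j) == val y i.
  have : sgval T (val y j) \in overtices y by rewrite -TyE !imset_f.
  by case/imsetP => i _ ->; exists i.
pose t j := xchoose (Ty j).
have tE j : sgval T (val y j) = val y (t j) by apply/eqP/(xchooseP (Ty j)).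
have t_inj : injective t.
  move=> i j ij; apply/(@osimplex_inj _ y)/(@perm_inj _ (sgval T)).
  by rewrite !tE ij.
pose s := (perm t_inj)^-1%g.
have sE j : sgval T (val y j) = val y ((s^-1)%g j) by rewrite invgK permE tE.
rewrite (bigD1 s) //= (introT (reorderP s) sE) mulr1 big1 ?addr0 => [|s' ss'].
  rewrite /overtices (odd_restr_perm_codom (@osimplex_inj _ y) sE).
  by rewrite odd_permV.
case: reorderP => [s'E|_]; last by rewrite mulr0.
case/eqP: ss'; apply: invg_inj; apply/permP => j.
by apply: (@osimplex_inj _ y); rewrite -s'E sE.
Qed.

Lemma sdim_lt_card (x : {set G}) : x \in simplices G -> (sdim x < #|G|)%N.
Proof.
rewrite inE -card_gt0 => /andP[x_gt0 _].
by rewrite /sdim prednK // max_card.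
Qed.

(** The Lefschetz fixed point formula for a graph automorphism. *)
Theorem lefschetz_fixed_point : lefschetz_number R T =
  \sum_(x in simplices G | sgval T @: x == x) lefschetz_index R (sgval T) x.
Proof.
rewrite hopf_trace.
transitivity (\sum_(k < #|G|) \sum_(x in simplices G | sdim x == k)
    if sgval T @: x == x then lefschetz_index R (sgval T) x else 0).
  apply: eq_bigr => k _; rewrite lftrace_forms.
  pose F (x : {set G}) : R :=
    if sgval T @: x == x then (-1) ^+ restr_perm x (sgval T) else 0.
  under [X in _ * (_ * X)]eq_bigr do rewrite sum_reorder_image -/(F _).
  rewrite sum_overtices.
  rewrite mulKf ?pnatr_eq0 -?lt0n ?fact_gt0 // mulr_sumr.
  apply: eq_big => [x | x /andP[_ /eqP x_card]].
    rewrite inE -card_gt0 /sdim; case: #|x| => //= n.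
  by rewrite /F /lefschetz_index /sdim x_card; case: ifP; rewrite ?mulr0.
rewrite (exchange_big_dep (mem (simplices G))) /= => [|k x _ /andP[]//].
rewrite [RHS]big_mkcondr; apply: eq_bigr => x xG.
by rewrite (big_pred1 (Ordinal (sdim_lt_card xG))) // => k; rewrite xG eq_sym.
Qed.
End TraceForms.

(** * The average over the automorphism group *)

Theorem theorem5p1 (R : realType) (G : sgraph) :
  \sum_(x in simplices G) lefschetz_curvature R x =
    average_lefschetz_number R G.
Proof.
rewrite /average_lefschetz_number /lefschetz_curvature -mulr_sumr.
congr (_ * _); under [RHS]eq_bigr do rewrite lefschetz_fixed_point.
rewrite (exchange_big_dep (mem (graph_aut G))) /= => [|x T _]; last first.
  by rewrite inE => /andP[].
rewrite (reindex_onto sgval (subg (graph_aut_group G))) /= => [|T]; last first.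
  exact: subgK.
apply: eq_big => [T | T _]; first by rewrite subgP sgvalK eqxx.
by apply: eq_bigl => x; rewrite [_ \in stabilizer x]inE (subgP T).
Qed.
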